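(* Let $A|H$ and $B|K$ be conditional events. Then, with conjunction and disjunction understood as conditional random quantities in the setting of coherence, $$(A|H)\vee(B|K)=(A|H)+[(\overline{A}|H)\wedge(B|K)],$$ that is, the two sides take the same value in every case.
   Context: Events are elements of a Boolean algebra, $\overline{E}$ is negation, juxtaposition is conjunction, and an event is identified with its $\{0,1\}$-valued indicator; $\mathbb{P}$ denotes prevision. Conditioning events are not impossible. For a random quantity $X$ with finitely many values, an event $H\neq\emptyset$ and an assessed prevision $\mu=\mathbb{P}(X|H)$, the conditional random quantity is $X|H=XH+\mu\overline{H}$. In particular the indicator of a conditional event is $A|H=AH+x\overline{H}$ with $x=P(A|H)$. Coherence: an assessment $(\mu_1,\ldots,\mu_n)$ on conditional random quantities $X_1|H_1,\ldots,X_n|H_n$ is coherent if for every nonempty $J\subseteq\{1,\ldots,n\}$ and all real $s_i$ $(i\in J)$, the values of $G=\sum_{i\in J}s_iH_i(X_i-\mu_i)$ restricted to $\bigvee_{i\in J}H_i$ satisfy $\min G\le 0\le\max G$. The probabilities and previsions of all conditional events, conjunctions and disjunctions involved are assumed to be jointly coherent (so $P(\overline{A}|H)=1-P(A|H)$). Conjunction: given $x=P(A|H)$ and $y=P(B|K)$, $(A|H)\wedge(B|K)=(AHBK+x\,\overline{H}BK+y\,AH\overline{K})\,|\,(H\vee K)$, so its value on $\overline{H}\,\overline{K}$ is its prevision $\mathbb{P}[(A|H)\wedge(B|K)]$. Correspondingly $(\overline{A}|H)\wedge(B|K)=(\overline{A}HBK+(1-x)\overline{H}BK+y\,\overline{A}H\overline{K})\,|\,(H\vee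 K)$. Disjunction: $(A|H)\vee(B|K)=((AH\vee BK)+x\,\overline{H}\,\overline{B}K+y\,\overline{A}H\overline{K})\,|\,(H\vee K)$, so its value on $\overline{H}\,\overline{K}$ is its prevision $\mathbb{P}[(A|H)\vee(B|K)]$. *)

(* Defs.v *)
From mathcomp Require Import all_boot all_order all_algebra.
From mathcomp Require Import reals.

Set Implicit Arguments.
Unset Strict Implicit.
Unset Printing Implicit Defensive.

Import Order.TTheory GRing.Theory Num.Theory.
Local Open Scope ring_scope.

(* Events are the elements of an arbitrary Boolean algebra T.  A possible world
   settles every event consistently, i.e. it is a Boolean homomorphism
   T -> {0,1} (meet and complement force the values at bottom and top); in
   particular events are identified with 0/1-valued indicators on worlds.
   By Stone's theorem an event is \bot iff it is false in every world, so the
   nonempty constituents of a finite set of events are exactly the patterns of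
   truth values realised by worlds, and quantifying over worlds is quantifying
   over all possible cases.  The library's {tblmorphism T -> bool} is not used
   because it does not require meets and joins to be preserved. *)
Record world disp (T : ctbDistrLatticeType disp) := World {
  holds :> T -> bool;
  holdsI : forall E F : T, holds (E `&` F)%O = holds E && holds F;
  holdsU : forall E F : T, holds (E `|` F)%O = holds E || holds F;
  holdsC : forall E : T, holds (~` E)%O = ~~ holds E
}.

Section ConditionalRandomQuantities.

Context {R : realType} {disp : Order.disp_t} {T : ctbDistrLatticeType disp}.

Implicit Types (w : world T) (E : T).

Definition ind E (w : world T) : R := (w E)%:R.

(* The pair (X, H) underlying X|H, before any prevision is assessed.  Finiteness
   of the range of X is not imposed: the quantities built below are linear
   combinations of indicators, hence finitely valued. *)
Record condRQ := CondRQ { quantity : world T -> R; hypothesis : T }.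

Record condEvent := CondEvent { conclusion : T; antecedent : T }.

Definition condRQ_of_condEvent (C : condEvent) : condRQ :=
  CondRQ (ind (conclusion C)) (antecedent C).

Definition condNeg (C : condEvent) : condEvent :=
  CondEvent (~` (conclusion C))%O (antecedent C).

Definition least (V : R -> Prop) (m : R) := V m /\ forall v, V v -> m <= v.
Definition greatest (V : R -> Prop) (m : R) := V m /\ forall v, V v -> v <= m.

Definition gain n (X : 'I_n -> condRQ) (mu : 'I_n -> R)
    (J : {set 'I_n}) (s : 'I_n -> R) (w : world T) : R :=
  \sum_(i in J) s i * ind (hypothesis (X i)) w * (quantity (X i) w - mu i).

Definition restricted_gain_value n (X : 'I_n -> condRQ) (mu : 'I_n -> R)
    (J : {set 'I_n}) (s : 'I_n -> R) (v : R) : Prop :=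
  exists2 w : world T,
    w (\join_(i in J) hypothesis (X i))%O & v = gain X mu J s w.

(* For finitely many finitely valued quantities the minimum and the maximum
   below always exist, provided the conditioning events are not impossible. *)
Definition coherent n (X : 'I_n -> condRQ) (mu : 'I_n -> R) : Prop :=
  forall (J : {set 'I_n}) (s : 'I_n -> R), J != set0 ->
  exists m M : R,
    [/\ least (restricted_gain_value X mu J s) m,
        greatest (restricted_gain_value X mu J s) M
      & m <= 0 <= M].

(* P X is the prevision assessed for X. *)
Variable P : condRQ -> R.

Definition prob (C : condEvent) : R := P (condRQ_of_condEvent C).

Definition coherent_on n (X : n.-tuple condRQ) : Prop :=
  coherent (tnth X) (fun i => P (tnth X i)).

(* The conditional random quantity X|H = X H + mu ~H, with mu its prevision. *)
Definition value (X : condRQ) (w : world T) : R :=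
  quantity X w * ind (hypothesis X) w + P X * ind (~` hypothesis X)%O w.

Definition condAnd (C D : condEvent) : condRQ :=
  let A := conclusion C in let H := antecedent C in
  let B := conclusion D in let K := antecedent D in
  CondRQ
    (fun w => ind (A `&` H `&` B `&` K)%O w
              + prob C * ind (~` H `&` B `&` K)%O w
              + prob D * ind (A `&` H `&` ~` K)%O w)
    (H `|` K)%O.

Definition condOr (C D : condEvent) : condRQ :=
  let A := conclusion C in let H := antecedent C in
  let B := conclusion D in let K := antecedent D in
  CondRQ
    (fun w => ind ((A `&` H) `|` (B `&` K))%O w
              + prob C * ind (~` H `&` ~` B `&` K)%O w
              + prob D * ind (~` A `&` H `&` ~` K)%O w)
    (H `|` K)%O.

End ConditionalRandomQuantities.

Arguments condRQ R {disp} T.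
Arguments condEvent {disp} T.

(* Main.v *)
Require Import Defs.
From mathcomp Require Import all_boot all_order all_algebra.
From mathcomp Require Import reals.
From mathcomp Require Import ring.

Import Order.TTheory GRing.Theory Num.Theory.
Local Open Scope ring_scope.

(** On the worlds of [H `|` K] the identity is a check of the possible cases,
    in which the only delicate one is [~` H `&` B `&` K]: there the two sides are
    [1] and [P (A | H) + P (~` A | H)].  Elsewhere all three conditional
    quantities take their previsions as values, so the identity says that the prevision of
    the disjunction is the sum of the other two.  Both equations between
    previsions come from coherence by [coherent_constant_gain]: a combination
    of bets whose gain is the same in all the relevant cases must have gain
    zero.  For [condNeg_prob] the bets are on [A | H] and its negation; for
    [condOr_prevision] one bets on the disjunction and against the two
    summands, the gain being constant by [condOr_quantity]. *)

(** The least and the greatest restricted gain coincide here, and [0] lies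
    between them.  That the set of relevant worlds is nonempty is part of
    coherence, since the two extreme values are attained. *)
Lemma coherent_constant_gain (R : realType) (disp : Order.disp_t)
    (T : ctbDistrLatticeType disp) (n : nat) (X : 'I_n -> condRQ R T)
    (mu : 'I_n -> R) (J : {set 'I_n}) (s : 'I_n -> R) (k : R) :
  coherent X mu -> J != set0 ->
  (forall w : world T, w (\join_(i in J) hypothesis (X i))%O ->
     gain X mu J s w = k) ->
  k = 0.
Proof.
move=> coh J0 Gk; have [m [M [[[w wJ ->] _] [[w' wJ' ->] _]]]] := coh J s J0.
by rewrite !Gk // => /le_anti.
Qed.

(** Betting one unit on each of [A | H] and [~` A | H] gains
    [1 - P (A | H) - P (~` A | H)] throughout [H]. *)
Lemma condNeg_prob (R : realType) (disp : Order.disp_t)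
    (T : ctbDistrLatticeType disp) (P : condRQ R T -> R) (n : nat)
    (X : n.-tuple (condRQ R T)) (C : condEvent T) (i j : 'I_n) :
  coherent_on P X -> i != j ->
  tnth X i = condRQ_of_condEvent C ->
  tnth X j = condRQ_of_condEvent (condNeg C) ->
  prob P (condNeg C) = 1 - prob P C.
Proof.
move=> coh ij Xi Xj; apply/eqP; rewrite eq_sym -subr_eq0; apply/eqP.
apply: (coherent_constant_gain _ _ _ _ _ _ [set i; j] (fun=> 1) _ coh).
  by apply/set0Pn; exists i; rewrite set21.
move=> w; rewrite /gain !big_setU1 ?inE //= !big_set1 Xi Xj /=.
rewrite holdsU orbb /ind holdsC => ->.
rewrite -/(prob P C) -/(prob P (condNeg C)).
by case: (w _) => /=; ring.
Qed.

(** The case check for the asserted identity on [H `|` K]; the hypothesis on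
    the negation serves the case [~` H `&` B `&` K]. *)
Lemma condOr_quantity (R : realType) (disp : Order.disp_t)
    (T : ctbDistrLatticeType disp) (P : condRQ R T -> R) (C D : condEvent T)
    (w : world T) :
  prob P (condNeg C) = 1 - prob P C ->
  w (antecedent C `|` antecedent D)%O ->
  quantity (condOr P C D) w
  = value P (condRQ_of_condEvent C) w + quantity (condAnd P (condNeg C) D) w.
Proof.
rewrite holdsU /value /= => -> wHK.
rewrite -/(prob P C) /ind !(holdsI, holdsU, holdsC).
move: wHK; case: (w (antecedent C)); case: (w (antecedent D)) => //= _;
  by case: (w (conclusion C)); case: (w (conclusion D)) => /=; ring.
Qed.

(** Bets with stakes [1], [-1], [-1] on the disjunction, on [A | H] and on the
    conjunction.  Adding the bet on [A | H] does not enlarge the set [H `|` K]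
    of relevant cases, and where [H] fails that bet is called off, which agrees
    with [A | H] taking there the value [P (A | H)]. *)
Lemma condOr_prevision (R : realType) (disp : Order.disp_t)
    (T : ctbDistrLatticeType disp) (P : condRQ R T -> R) (n : nat)
    (X : n.-tuple (condRQ R T)) (C D : condEvent T) (i j k : 'I_n) :
  coherent_on P X -> uniq [:: i; j; k] ->
  prob P (condNeg C) = 1 - prob P C ->
  tnth X i = condOr P C D ->
  tnth X j = condRQ_of_condEvent C ->
  tnth X k = condAnd P (condNeg C) D ->
  P (condOr P C D) = prob P C + P (condAnd P (condNeg C) D).
Proof.
move=> coh /=; rewrite !inE negb_or andbT => /andP[/andP[ij ik] jk] negC Xi Xj Xk.
apply/eqP; rewrite eq_sym -subr_eq0; apply/eqP.
pose s l : R := if l == i then 1 else -1.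
apply: (coherent_constant_gain _ _ _ _ _ _ (i |: [set j; k]) s _ coh).
  by apply/set0Pn; exists i; rewrite setU11.
move=> w; rewrite /gain !big_setU1 ?inE ?negb_or ?ij ?ik //= !big_set1.
rewrite /s eqxx ![_ == i]eq_sym (negbTE ij) (negbTE ik) Xi Xj Xk.
move=> wJ; have wHK : w (antecedent C `|` antecedent D)%O.
  move: wJ; rewrite /= !holdsU.
  by case: (w (antecedent C)); case: (w (antecedent D)).
rewrite (condOr_quantity _ _ _ P C D w negC wHK).
rewrite {1 3}/ind /= wHK /value /= -/(prob P C) /ind holdsC.
by case: (w (antecedent C)) => /=; ring.
Qed.

Theorem mainTheorem5 (R : realType) (disp : Order.disp_t)
    (T : ctbDistrLatticeType disp) (P : condRQ R T -> R)
    (AH BK : condEvent T)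
    (H_possible : antecedent AH != \bot%O)
    (K_possible : antecedent BK != \bot%O)
    (P_coherent : coherent_on P
       [tuple condRQ_of_condEvent AH; condRQ_of_condEvent BK;
              condRQ_of_condEvent (condNeg AH);
              condAnd P (condNeg AH) BK; condOr P AH BK]) :
  forall w : world T,
    value P (condOr P AH BK) w
    = value P (condRQ_of_condEvent AH) w + value P (condAnd P (condNeg AH) BK) w.
Proof.
move=> w.
have negAH : prob P (condNeg AH) = 1 - prob P AH.
  exact: (condNeg_prob _ _ _ _ _ _ AH (@Ordinal 5 0 isT) (@Ordinal 5 2 isT)
            P_coherent).
have PrOr : P (condOr P AH BK) = prob P AH + P (condAnd P (condNeg AH) BK).
  exact: (condOr_prevision _ _ _ _ _ _ AH BK (@Ordinal 5 4 isT)
            (@Ordinal 5 0 isT) (@Ordinal 5 3 isT) P_coherent).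
have [wHK|wHK] := boolP (w (antecedent AH `|` antecedent BK)%O).
  rewrite {1}/value (condOr_quantity _ _ _ P AH BK w negAH wHK).
  rewrite {3}/value /ind !holdsC /= wHK /=; ring.
rewrite /value PrOr /ind !holdsC /= (negbTE wHK).
have /negbTE-> : ~~ w (antecedent AH).
  by move: wHK; rewrite holdsU negb_or => /andP[].
by rewrite -/(prob P AH) /=; ring.
Qed.
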